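(* Let $x\neq 0$ be real. For all positive integers $k$ and $n$, $$\sum_{j=0}^{n-k}\binom{n}{j}x^{j-k}B_k^{n-j}(x)=\binom{n}{k},$$ where $B_k^n$ denotes the Bernstein basis function.
   Context: The Bernstein basis functions are $B_k^n(x)=\binom{n}{k}x^k(1-x)^{n-k}$ for integers $0\le k\le n$ (with $0^0=1$). If $n<k$ the sum is empty (equal to $0$) and $\binom{n}{k}=0$. *)

(* Defs.v *)
From HB Require Import structures.
From mathcomp Require Import all_boot all_order all_algebra.
From mathcomp Require Import reals.

Set Implicit Arguments.
Unset Strict Implicit.
Unset Printing Implicit Defensive.

Import Order.TTheory GRing.Theory Num.Theory.
Local Open Scope ring_scope.

(* For n < k the natural-number subtraction n - k truncates to 0, but the
   factor 'C(n, k) = 0 makes the value 0. *)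
Definition bernstein (R : realType) (n k : nat) (x : R) : R :=
  'C(n, k)%:R * x ^+ k * (1 - x) ^+ (n - k).

(* Main.v *)
Require Import Defs.
From HB Require Import structures.
From mathcomp Require Import all_boot all_order all_algebra.
From mathcomp Require Import reals.

Set Implicit Arguments.
Unset Strict Implicit.
Unset Printing Implicit Defensive.

Import Order.TTheory GRing.Theory Num.Theory.
Local Open Scope ring_scope.

(** The power [x ^ (j - k)] cancels the factor [x ^+ k] of the Bernstein function. By [mul_bin_bin]
    the [j]-th term is then ['C(n, k)] times the [j]-th term of the binomial expansion of
    [((1 - x) + x) ^+ (n - k) = 1]. *)

(** Either side, multiplied by j! k! (n - j - k)!, gives n!. *)
Lemma mul_bin_bin (n j k : nat) : (j + k <= n)%N ->
  ('C(n, j) * 'C(n - j, k) = 'C(n, k) * 'C(n - k, j))%N.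
Proof.
move=> le_jk_n.
have mulbin_fact a b : (a + b <= n)%N ->
    ('C(n, a) * 'C(n - a, b) * (a`! * b`! * (n - (a + b))`!) = n`!)%N.
  move=> le_ab_n; have le_bna : (b <= n - a)%N
    by rewrite leq_subRL // (leq_trans (leq_addr b a)).
  rewrite -(bin_fact (leq_trans (leq_addr b a) le_ab_n)) -(bin_fact le_bna) subnDA.
  by rewrite -!mulnA; congr (_ * _)%N; rewrite mulnCA.
have fact_pos : (0 < j`! * k`! * (n - (j + k))`!)%N by rewrite !muln_gt0 !fact_gt0.
apply/eqP; rewrite -(eqn_pmul2r fact_pos) mulbin_fact //.
by rewrite [(j`! * _)%N]mulnC [(j + k)%N]addnC mulbin_fact // addnC.
Qed.

(* MathComp world.  The range 0 <= j < n.+1 - k is 0, ..., n - k when k <= n and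
   is empty when n < k; the exponent j - k is an integer. *)
Theorem theorem12 (R : realType) (x : R) (hx : x != 0) (k n : nat)
    (hk : (0 < k)%N) (hn : (0 < n)%N) :
  \sum_(0 <= j < n.+1 - k)
     'C(n, j)%:R * x ^ (j%:Z - k%:Z) * bernstein (n - j) k x
  = 'C(n, k)%:R.
Proof.
have [lt_nk | le_kn] := ltnP n k.
  (* [n < k] unfolds to [n.+1 - k == 0], so the range is empty. *)
  by rewrite bin_small // (eqP lt_nk) big_geq.
(* With [x] as second summand, [exprDn] attaches [x ^+ j] to index [j]. *)
have partition_unity : 'C(n, k)%:R = 'C(n, k)%:R * (1 - x + x) ^+ (n - k) :> R.
  by rewrite subrK expr1n mulr1.
rewrite partition_unity subSn // exprDn big_distrr /= big_mkord.
apply: eq_bigr => j _.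
have le_jk_n : (j + k <= n)%N by rewrite addnC -leq_subRL // -ltnS ltn_ord.
have -> : x ^ (j%:Z - k%:Z) = x ^+ j / x ^+ k by rewrite expfzDr // -invr_expz.
have bin_eq : 'C(n, j)%:R * 'C(n - j, k)%:R = 'C(n, k)%:R * 'C(n - k, j)%:R :> R.
  by rewrite -!natrM mul_bin_bin.
rewrite /bernstein -!subnDA [(k + j)%N]addnC -!mulrA.
rewrite [x ^- k * _]mulrCA mulKf ?expf_neq0 // [x ^+ j * _]mulrCA.
rewrite [LHS]mulrA bin_eq -mulrA; congr (_ * _).
by rewrite mulr_natl [x ^+ j * _]mulrC.
Qed.
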